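(* Let $P:\mathcal M\times\mathcal M\to\{0,1\}$ be a binary predicate computable by a polynomial-size circuit and let $\Pi_{\mathsf{CondEnc}}$ be the conditional encryption construction for $P$ from a fully homomorphic encryption scheme $\Pi_{\mathsf{FHE}}$ described in the context. Assuming that $\Pi_{\mathsf{FHE}}$ satisfies perfect correctness, $\Pi_{\mathsf{CondEnc}}$ satisfies perfect correctness and perfect error detection, i.e. it is $1-\epsilon(\lambda)$-error detecting and $1-\epsilon(\lambda)$-correct with $\epsilon(\lambda)=0$.
   Context: **Conditional encryption.** A conditional encryption scheme for $P$ consists of $(\mathsf{KeyGen},\mathsf{Enc},\mathsf{CondEnc},\mathsf{Dec})$, where $\mathsf{Enc}_{pk}(m)$ outputs a ciphertext with flag $0$, $\mathsf{CondEnc}_{pk}(c,m_2,m_3)$ takes a flag-$0$ ciphertext, a control message $m_2$ and a payload $m_3$ and outputs a ciphertext with flag $1$, and $\mathsf{Dec}_{sk}$ outputs a message in $\mathcal M$ or $\bot$. *Correctness.* $1-\epsilon(\cdot)$-correct means: (i) for all coins $r_1,r_2$ and $m\in\mathcal M$, with $(sk,pk)=\mathsf{KeyGen}(1^\lambda;r_1)$, $\mathsf{Dec}_{sk}(\mathsf{Enc}_{pk}(m;r_2))=m$; (ii) for all $r_1,r_2$ and all $m_1,m_2,m_3\in\mathcal M$ with $P(m_1,m_2)=1$, $\Pr_{r_3}[\mathsf{Dec}_{sk}(\mathsf{CondEnc}_{pk}(\mathsf{Enc}_{pk}(m_1;r_2),m_2,m_3;r_3))=m_3]\ge1-\epsilon(\lambda)$.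 *Error detection.* $1-\epsilon(\cdot)$-error detecting means: for all $r_1,r_2$ and all $m_1,m_2,m_3\in\mathcal M$ with $P(m_1,m_2)=0$, $\Pr_{r_3}[\mathsf{Dec}_{sk}(\mathsf{CondEnc}_{pk}(\mathsf{Enc}_{pk}(m_1;r_2),m_2,m_3;r_3))=\bot]\ge1-\epsilon(\lambda)$. **FHE perfect correctness.** For all keys $(sk,pk)$ in the support of key generation and all plaintexts $m$, $\mathsf{Dec}_{sk}(\mathsf{Enc}_{pk}(m))=m$ always, and for all circuits $C$ in the supported class and every $c$ in the image of $\mathsf{Enc}_{pk}(m)$, $\mathsf{Dec}_{sk}(\mathsf{Eval}_{pk}(C,c))=C(m)$ always. **The construction.** $Z$ is a fixed, publicly known constant that lies in the FHE message space but outside $\mathcal M$ (the FHE message space contains $\mathcal M$). $C_{P,m_2,m_3}$ is the circuit that on input $m_1$ outputs $m_3$ if $P(m_1,m_2)=1$ and $Z$ if $P(m_1,m_2)=0$; the FHE scheme supports these circuits. - $\Pi_{\mathsf{CondEnc}}.\mathsf{KeyGen}(1^\lambda)$ is the FHE key generation. - $\Pi_{\mathsf{CondEnc}}.\mathsf{Enc}_{pk}(m_1)=(0,\Pi_{\mathsf{FHE}}.\mathsf{Enc}_{pk}(m_1))$. - $\Pi_{\mathsf{CondEnc}}.\mathsf{CondEnc}_{pk}((0,c),m_2,m_3)=(1,\Pi_{\mathsf{FHE}}.\mathsf{Eval}_{pk}(C_{P,m_2,m_3},c))$. - $\Pi_{\mathsf{CondEnc}}.\mathsf{Dec}_{sk}(b,c)$: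 compute $m=\Pi_{\mathsf{FHE}}.\mathsf{Dec}_{sk}(c)$; return $\bot$ if $m\notin\mathcal M$, otherwise $m$. *)

(* Defs.v *)
From mathcomp Require Import all_boot all_order all_algebra.

Set Implicit Arguments.
Unset Strict Implicit.
Unset Printing Implicit Defensive.

Import Order.TTheory GRing.Theory Num.Theory.

Definition bits (n : nat) := n.-tuple bool.

(** * Boolean circuits *)

(* Straight-line programs of fan-in at most 2: wires [0 .. n-1] carry the
   input, and the j-th gate drives wire [n + j].  Wires may be read any number
   of times (unbounded fan-out), so the number of gates is the usual circuit
   size. *)
Inductive gate : Type :=
  | GConst of bool
  | GNot of nat
  | GAnd of nat & nat
  | GOr of nat & nat.

(* [w] is the number of wires already driven. *)
Definition gate_wf (w : nat) (g : gate) : bool :=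
  match g with
  | GConst _ => true
  | GNot i => i < w
  | GAnd i j | GOr i j => (i < w) && (j < w)
  end.

Fixpoint gates_wf (w : nat) (gs : seq gate) : bool :=
  if gs is g :: gs' then gate_wf w g && gates_wf w.+1 gs' else true.

Record circuit (n k : nat) := Circuit {
  gates : seq gate;
  outs : k.-tuple nat;
  circuit_wf : gates_wf n gates && all (fun i => i < n + size gates) outs }.

Definition circuit_size n k (C : circuit n k) : nat := size (gates C).

Definition gate_eval (w : seq bool) (g : gate) : bool :=
  match g with
  | GConst b => b
  | GNot i => ~~ nth false w i
  | GAnd i j => nth false w i && nth false w j
  | GOr i j => nth false w i || nth false w j
  end.

Fixpoint run_gates (w : seq bool) (gs : seq gate) : seq bool :=
  if gs is g :: gs' then run_gates (rcons w (gate_eval w g)) gs' else w.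

Definition circuit_eval n k (C : circuit n k) (x : bits n) : bits k :=
  [tuple of map (nth false (run_gates x (gates C))) (outs C)].

Definition poly_size (n k : nat -> nat)
    (C : forall lam, circuit (n lam) (k lam)) : Prop :=
  exists p : {poly nat}, forall lam, circuit_size (C lam) <= p.[lam]%R.

(** * Probability over uniform coins *)

Definition prob (R : realFieldType) (n : nat) (E : pred (bits n)) : R :=
  (#|E|%:R / #|{: bits n}|%:R)%R.

(** * Conditional encryption *)

(* All algorithms are deterministic functions of explicit coins, indexed by
   the security parameter.  A ciphertext is a pair (flag, body), the flag bits
   0 and 1 being [false] and [true]; [None] stands for the failure symbol. *)
Record cond_enc (M : nat -> Type) := CondEncScheme {
  ce_sk : nat -> Type;
  ce_pk : nat -> Type;
  ce_ct : nat -> Type;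
  ce_rkey : nat -> nat;
  ce_renc : nat -> nat;
  ce_rcond : nat -> nat;
  ce_keygen : forall lam, bits (ce_rkey lam) -> ce_sk lam * ce_pk lam;
  ce_enc : forall lam, ce_pk lam -> M lam -> bits (ce_renc lam) ->
    bool * ce_ct lam;
  (* only meaningful when the input ciphertext has flag 0 *)
  ce_condenc : forall lam, ce_pk lam -> bool * ce_ct lam -> M lam -> M lam ->
    bits (ce_rcond lam) -> bool * ce_ct lam;
  ce_dec : forall lam, ce_sk lam -> bool * ce_ct lam -> option (M lam);
  ce_enc_flag : forall lam (pk : ce_pk lam) m r, (ce_enc pk m r).1 = false;
  ce_condenc_flag : forall lam (pk : ce_pk lam) c m2 m3 r,
    c.1 = false -> (ce_condenc pk c m2 m3 r).1 = true }.

Definition predicate (M : nat -> Type) := forall lam, M lam -> M lam -> bool.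

Definition cond_enc_correct (R : realFieldType) (M : nat -> eqType)
    (P : predicate M) (S : cond_enc M) (eps : nat -> R) : Prop :=
  (forall lam (r1 : bits (ce_rkey S lam)) (r2 : bits (ce_renc S lam))
      (m : M lam),
    let: (sk, pk) := ce_keygen r1 in
    ce_dec sk (ce_enc pk m r2) = Some m)
  /\
  (forall lam (r1 : bits (ce_rkey S lam)) (r2 : bits (ce_renc S lam))
      (m1 m2 m3 : M lam),
    P lam m1 m2 = true ->
    let: (sk, pk) := ce_keygen r1 in
    (1 - eps lam <=
     prob R [pred r3 : bits (ce_rcond S lam) |
       ce_dec sk (ce_condenc pk (ce_enc pk m1 r2) m2 m3 r3) == Some m3])%R).

Definition cond_enc_error_detecting (R : realFieldType) (M : nat -> eqType)
    (P : predicate M) (S : cond_enc M) (eps : nat -> R) : Prop :=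
  forall lam (r1 : bits (ce_rkey S lam)) (r2 : bits (ce_renc S lam))
      (m1 m2 m3 : M lam),
    P lam m1 m2 = false ->
    let: (sk, pk) := ce_keygen r1 in
    (1 - eps lam <=
     prob R [pred r3 : bits (ce_rcond S lam) |
       ce_dec sk (ce_condenc pk (ce_enc pk m1 r2) m2 m3 r3) == None])%R.

(** * Fully homomorphic encryption *)

(* The message space at parameter [lam] is a set of strings of length
   [fhe_len lam]; [fhe_supported] is the class of circuits that the scheme can
   evaluate. *)
Record fhe := FHEScheme {
  fhe_len : nat -> nat;
  fhe_msg : forall lam, {set bits (fhe_len lam)};
  fhe_supported : forall lam, circuit (fhe_len lam) (fhe_len lam) -> Prop;
  fhe_sk : nat -> Type;
  fhe_pk : nat -> Type;
  fhe_ct : nat -> Type;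
  fhe_rkey : nat -> nat;
  fhe_renc : nat -> nat;
  fhe_reval : nat -> nat;
  fhe_keygen : forall lam, bits (fhe_rkey lam) -> fhe_sk lam * fhe_pk lam;
  fhe_enc : forall lam, fhe_pk lam -> bits (fhe_len lam) ->
    bits (fhe_renc lam) -> fhe_ct lam;
  fhe_eval : forall lam, fhe_pk lam -> circuit (fhe_len lam) (fhe_len lam) ->
    fhe_ct lam -> bits (fhe_reval lam) -> fhe_ct lam;
  fhe_dec : forall lam, fhe_sk lam -> fhe_ct lam ->
    option (bits (fhe_len lam)) }.

Definition fhe_perfectly_correct (F : fhe) : Prop :=
  forall lam (sk : fhe_sk F lam) (pk : fhe_pk F lam),
  (exists r1 : bits (fhe_rkey F lam), fhe_keygen r1 = (sk, pk)) ->
  forall m, m \in fhe_msg F lam ->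
    (forall r2 : bits (fhe_renc F lam),
       fhe_dec sk (fhe_enc pk m r2) = Some m)
    /\
    (forall (C : circuit (fhe_len F lam) (fhe_len F lam)) (c : fhe_ct F lam),
       fhe_supported C ->
       (exists r2 : bits (fhe_renc F lam), c = fhe_enc pk m r2) ->
       forall r : bits (fhe_reval F lam),
         fhe_dec sk (fhe_eval pk C c r) = Some (circuit_eval C m)).

(** * The construction *)

Notation msg_type M := {x | x \in M}.

(* [CP] computes [P] on the concatenation of its two arguments. *)
Definition computes (len : nat -> nat) (M : forall lam, {set bits (len lam)})
    (CP : forall lam, circuit (len lam + len lam) 1)
    (P : predicate (fun lam => msg_type (M lam))) : Prop :=
  forall lam (m1 m2 : msg_type (M lam)),
    circuit_eval (CP lam) [tuple of val m1 ++ val m2] = [tuple P lam m1 m2].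

Section CondCircuit.

Variables (n : nat) (CP : circuit (n + n) 1) (Z m2 m3 : bits n).

(* The hardwired bits of [m2] occupy wires [n .. 2n-1], exactly where [CP]
   expects its second argument, so the gates of [CP] need no renumbering. *)
Definition cond_gates : seq gate :=
  map GConst m2 ++ gates CP ++
  [:: GConst false; GConst true; GNot (thead (outs CP))].

(* Bit i is (p && m3_i) || (~~ p && Z_i), where p is the output of [CP];
   since m3_i and Z_i are constants, it is one of false, true, p, ~~ p. *)
Definition cond_outs : n.-tuple nat :=
  let s := n + n + size (gates CP) in
  [tuple (match tnth m3 i, tnth Z i with
          | false, false => s
          | true, true => s.+1
          | true, false => thead (outs CP)
          | false, true => s.+2
          end) | i < n].

Lemma gates_wf_cat w gs1 gs2 :
  gates_wf w (gs1 ++ gs2) = gates_wf w gs1 && gates_wf (w + size gs1) gs2.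
Proof.
elim: gs1 w => [|g gs1 IH] w /=; first by rewrite addn0.
by rewrite IH addSnnS andbA.
Qed.

Lemma cond_circuit_wf :
  gates_wf n cond_gates && all (fun i => i < n + size cond_gates) cond_outs.
Proof.
have /andP[wfg wfo] := circuit_wf CP.
have lt_p : thead (outs CP) < n + n + size (gates CP).
  exact: (allP wfo) (mem_tnth _ _).
have wf_m2 : gates_wf n (map GConst m2).
  by move: {1}n (tval m2) => w s; elim: s w => //= b s IH w; apply: IH.
rewrite !gates_wf_cat size_map size_tuple wfg wf_m2 /= andbT.
rewrite ltnS (leqW (ltnW lt_p)) /=.
apply/allP => _ /mapP[i _ ->].
rewrite !size_cat size_map size_tuple /= !addnA addn3.
by case: (tnth m3 i); case: (tnth Z i); rewrite ?ltnS ?leqnSn ?leqnn ?leqW ?(ltnW lt_p).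
Qed.

Definition cond_circuit : circuit n n := Circuit cond_circuit_wf.

End CondCircuit.

Section Construction.

Variables (F : fhe) (M : forall lam, {set bits (fhe_len F lam)}).
Variable Z : forall lam, bits (fhe_len F lam).
Variable CP : forall lam, circuit (fhe_len F lam + fhe_len F lam) 1.

Let msg lam := msg_type (M lam).

Definition fce_enc lam (pk : fhe_pk F lam) (m1 : msg lam)
    (r : bits (fhe_renc F lam)) : bool * fhe_ct F lam :=
  (false, fhe_enc pk (val m1) r).

Definition fce_condenc lam (pk : fhe_pk F lam) (bc : bool * fhe_ct F lam)
    (m2 m3 : msg lam) (r : bits (fhe_reval F lam)) : bool * fhe_ct F lam :=
  (true, fhe_eval pk (cond_circuit (CP lam) (Z lam) (val m2) (val m3)) bc.2 r).

(* [insub x] is [None] when [x] lies outside [M lam]. *)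
Definition fce_dec lam (sk : fhe_sk F lam) (bc : bool * fhe_ct F lam) :
    option (msg lam) :=
  obind insub (fhe_dec sk bc.2).

Definition fhe_cond_enc : cond_enc msg :=
  @CondEncScheme msg (fhe_sk F) (fhe_pk F) (fhe_ct F)
    (fhe_rkey F) (fhe_renc F) (fhe_reval F)
    (@fhe_keygen F) fce_enc fce_condenc fce_dec
    (fun _ _ _ _ => erefl) (fun _ _ _ _ _ _ _ => erefl).

End Construction.

(* Main.v *)
(* Hardwiring the bits of [m2] as constant gates makes the wires of the circuit
   for [P] on [m1 ++ m2] an initial segment of those of the conditional circuit,
   which thus outputs [m3] or [Z] according to [P m1 m2].  Since [Z] lies outside
   [M], decryption returns [m3] or fails accordingly, for every choice of coins;
   hence both events have probability 1. *)
Require Import Defs.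
From mathcomp Require Import all_boot all_order all_algebra.

Set Implicit Arguments.
Unset Strict Implicit.
Unset Printing Implicit Defensive.

Lemma run_gates_cat w gs1 gs2 :
  run_gates w (gs1 ++ gs2) = run_gates (run_gates w gs1) gs2.
Proof. by elim: gs1 w => /=. Qed.

Lemma run_gates_const w s : run_gates w (map GConst s) = w ++ s.
Proof. by elim: s w => [|b s IHs] w /=; rewrite ?cats0 // IHs cat_rcons. Qed.

(** Each gate drives exactly one new wire; this fixes the index at which later gates start
    writing. *)
Lemma size_run_gates w gs : size (run_gates w gs) = size w + size gs.
Proof.
by elim: gs w => [|g gs IHgs] w /=; rewrite ?addn0 // IHgs size_rcons addSnnS.
Qed.

Lemma thead_circuit_eval n k (C : circuit n k.+1) (x : bits n) :
  thead (circuit_eval C x) = nth false (run_gates x (gates C)) (thead (outs C)).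
Proof. by rewrite /thead tnth_map. Qed.

(** With [p] the output of [CP], each output bit is a function of [p] alone determined by the bits
    of [m3] and [Z]; the three final gates, together with [p] itself, supply all four such
    functions. *)
Lemma cond_circuit_eval n (CP : circuit (n + n) 1) (Z m1 m2 m3 : bits n) :
  circuit_eval (cond_circuit CP Z m2 m3) m1 =
  if thead (circuit_eval CP [tuple of m1 ++ m2]) then m3 else Z.
Proof.
have /andP[_ /allP outs_lt] := circuit_wf CP.
have out_lt : thead (outs CP) < n + n + size (gates CP).
  exact/outs_lt/mem_tnth.
apply: eq_from_tnth => i; rewrite thead_circuit_eval !tnth_map tnth_ord_tuple.
(* The constant gates turn the wires [m1] into [m1 ++ m2], the very input that [CP] expects. *)
rewrite /= /cond_gates !run_gates_cat run_gates_const.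
set w := run_gates (m1 ++ m2) (gates CP).
have size_w : size w = n + n + size (gates CP).
  by rewrite size_run_gates size_cat !size_tuple.
(* Indices become offsets from [size w], so that [nth_cat] separates the wires of [CP] from the
   three added ones. *)
rewrite /= -size_w in out_lt *.
set p := thead (outs CP) in out_lt *.
rewrite (fun_if (fun t : bits n => tnth t i)) -!cats1 -!catA /=.
(* The negation gate reads [p] after two constants were appended to [w]; since [p] indexes [w], the
   value is unchanged. *)
rewrite [in ~~ _]nth_cat out_lt.
case: (tnth m3 i) (tnth Z i) => [] []; rewrite nth_cat ?out_lt //.
- by rewrite ltnNge leqnSn subSnn if_same.
- by case: nth.
- by rewrite ltnNge leqW // -addn2 addKn; case: nth.
- by rewrite ltnn subnn if_same.
Qed.

Lemma prob_eq1 (R : realFieldType) n (E : pred (bits n)) :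
  (forall r, E r) -> prob R E = 1%R.
Proof.
move=> E_true; rewrite /prob (eq_card (B := {: bits n})) => [|r].
  (* The denominator is [2 ^ n], nonzero in characteristic 0. *)
  by rewrite GRing.divff // Num.Theory.pnatr_eq0 card_tuple card_bool expn_eq0.
by rewrite !inE; exact: E_true.
Qed.

Section PerfectCorrectness.

Variables (F : fhe) (M : forall lam, {set bits (fhe_len F lam)}).
Variable Z : forall lam, bits (fhe_len F lam).
Variable P : predicate (fun lam => msg_type (M lam)).
Variable CP : forall lam, circuit (fhe_len F lam + fhe_len F lam) 1.
Hypothesis P_computed : computes CP P.
Hypothesis M_sub : forall lam, M lam \subset fhe_msg F lam.
Hypothesis supports : forall lam (m2 m3 : msg_type (M lam)),
  fhe_supported (cond_circuit (CP lam) (Z lam) (val m2) (val m3)).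
Hypothesis F_correct : fhe_perfectly_correct F.
Variable lam : nat.
Variables (r1 : bits (fhe_rkey F lam)) (sk : fhe_sk F lam) (pk : fhe_pk F lam).
Hypothesis keygen_r1 : fhe_keygen r1 = (sk, pk).

Lemma fce_dec_enc (m : msg_type (M lam)) r2 :
  fce_dec M sk (fce_enc pk m r2) = Some m.
Proof.
have m_msg : val m \in fhe_msg F lam by exact: subsetP (M_sub lam) _ (valP m).
have [dec_enc _] := F_correct (ex_intro _ r1 keygen_r1) m_msg.
by rewrite /fce_dec dec_enc /= valK.
Qed.

(** Serves both correctness and error detection, one per branch. The right-hand side is free of [r2]
    and [r3] because evaluation is correct for all coins. *)
Lemma fce_dec_condenc (m1 m2 m3 : msg_type (M lam)) r2 r3 :
  fce_dec M sk (fce_condenc Z CP pk (fce_enc pk m1 r2) m2 m3 r3) =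
  if P m1 m2 then Some m3 else insub (Z lam).
Proof.
have m1_msg : val m1 \in fhe_msg F lam.
  exact: subsetP (M_sub lam) _ (valP m1).
have [_ dec_eval] := F_correct (ex_intro _ r1 keygen_r1) m1_msg.
rewrite /fce_dec /= dec_eval; [|exact: supports|by exists r2].
rewrite cond_circuit_eval P_computed theadE.
(* The payload lies in [M], so [insub] gives it back. *)
by case: (P m1 m2); rewrite /= ?valK.
Qed.

End PerfectCorrectness.

Theorem theorem14 (R : realFieldType) (F : fhe)
  (M : forall lam, {set bits (fhe_len F lam)})
  (Z : forall lam, bits (fhe_len F lam))
  (P : predicate (fun lam => msg_type (M lam)))
  (CP : forall lam, circuit (fhe_len F lam + fhe_len F lam) 1)
  (P_computed : computes CP P)
  (CP_poly_size : poly_size CP)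
  (M_sub : forall lam, M lam \subset fhe_msg F lam)
  (Z_msg : forall lam, Z lam \in fhe_msg F lam)
  (Z_notin : forall lam, Z lam \notin M lam)
  (supports : forall lam (m2 m3 : msg_type (M lam)),
     fhe_supported (cond_circuit (CP lam) (Z lam) (val m2) (val m3)))
  (F_correct : fhe_perfectly_correct F) :
  cond_enc_error_detecting P (fhe_cond_enc M Z CP) (fun _ => 0%R : R)
  /\ cond_enc_correct P (fhe_cond_enc M Z CP) (fun _ => 0%R : R).
Proof.
split; [|split] => lam r1 r2.
- move=> m1 m2 m3 P_false; case keygen_r1: (ce_keygen r1) => [sk pk].
  rewrite GRing.subr0 prob_eq1 // => r3 /=.
  rewrite (fce_dec_condenc P_computed M_sub supports F_correct keygen_r1).
  (* Here [Z] lying outside [M] turns the [insub] branch into failure. *)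
  by rewrite P_false insubN ?Z_notin.
- move=> m; case keygen_r1: (ce_keygen r1) => [sk pk].
  exact: (fce_dec_enc M_sub F_correct keygen_r1 m r2).
- move=> m1 m2 m3 P_true; case keygen_r1: (ce_keygen r1) => [sk pk].
  rewrite GRing.subr0 prob_eq1 // => r3 /=.
  rewrite (fce_dec_condenc P_computed M_sub supports F_correct keygen_r1).
  by rewrite P_true.
Qed.
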